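(* If the weak confidence intervals are jointly valid, i.e. on the event $\mathcal{E}=\bigcap_{x\in D}\{v(x)\in[L(x),U(x)]\}$ for the initial weak intervals $[L(x),U(x)]$, then the algorithm ACE (described in the context) returns the exact top-$k$ set $T_k^\star$. Moreover, it issues at most $m(4\varepsilon_{\max})$ strong oracle calls on $\mathcal{E}$ (and hence fails with probability at most $\delta$ overall), where $\varepsilon_{\max}=\max_{x\in D}\tfrac12(U(x)-L(x))$ is the maximum radius of the initial weak intervals.
   Context: Setting. $D=\{x_1,\dots,x_n\}$ is a set of items with an unknown valuation $v:D\to[0,1]$, and $1\le k<n$. Items are totally ordered by $v$ (ties broken deterministically by a fixed index order). $T_k^\star\subseteq D$ is the set of the $k$ items with largest $v$. $t^\star=v_{(k)}$ is the $k$-th largest value. For $\eta\ge0$ the near-tie mass is $m(\eta)=|\{x\in D:|v(x)-t^\star|\le\eta\}|$. Oracles. A query to the weak oracle $\mathsf W$ on $x$ returns a random value in $[0,1]$ with mean $v(x)$ and bounded variance; repeated queries are i.i.d. A query to the strong oracle $\mathsf S$ on $x$ returns $v(x)$ exactly. Weak intervals. After $N$ weak queries per item, each item has an interval $[L(x),U(x)]=[\hat v(x)-r_N(x),\hat v(x)+r_N(x)]$, where $\hat v(x)$ is the sample mean and $r_N(x)$ is a valid $(1-\delta_x)$-confidence half-width with $\sum_x\delta_x\le\delta$. Hence $\mathbb P(\mathcal E)\ge 1-\delta$. Algorithm ACE, with input $D,k,\delta,N$: 1. Build the initial weak intervals $[L(x),U(x)]$ for all $x\in D$ from $N$ weak queries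 per item, with joint coverage $1-\delta$. 2. Repeat: (a) let $S_k$ be the set of the $k$ items with largest current upper bounds $U(x)$; (b) let $i\in\arg\min_{x\in S_k}L(x)$ and $j\in\arg\max_{y\notin S_k}U(y)$; (c) if $L(i)\ge U(j)$, stop and return $S_k$; (d) otherwise let $x^\star\in\{i,j\}$ be the one whose current interval has larger width $U(\cdot)-L(\cdot)$, query $v^\star=\mathsf S(x^\star)$, and set $L(x^\star)=U(x^\star)=v^\star$.
   Formalization: If the k-th and (k+1)-th largest values tie, the test L(i) ≥ U(j) may return another set of k largest items; so equality with T_k* is stated when these values differ, or when all comparisons, including the stopping test, break ties by index. *)

(* Defs.v *)
From HB Require Import structures.
From mathcomp Require Import all_boot all_order all_algebra.
From mathcomp Require Import all_classical all_reals all_analysis.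
Set Implicit Arguments.
Unset Strict Implicit.
Unset Printing Implicit Defensive.
Import Order.TTheory GRing.Theory Num.Theory.
Import numFieldNormedType.Exports.
Local Open Scope ring_scope.

Section Ranking.
Context {R : realType} {n : nat}.
Implicit Types (f v L U : 'I_n -> R) (S : {set 'I_n}) (k : nat).

(* A comparison [ge] takes scores paired with the items carrying them, so that
   ties between scores can be resolved by the items. [ge_val] ignores the items;
   [ge_idx] breaks ties in favour of the smaller index, and is a total order. *)
Definition ge_val : rel (R * 'I_n) := fun p q => q.1 <= p.1.

Definition ge_idx : rel (R * 'I_n) :=
  fun p q => (q.1 < p.1) || ((p.1 == q.1) && (p.2 <= q.2)%N).

Definition is_topk (ge : rel (R * 'I_n)) f k S : Prop :=
  #|S| = k /\ forall x y, x \in S -> y \notin S -> ge (f x, x) (f y, y).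

Definition topk f k : {set 'I_n} :=
  [set x | (#|[set y | (y != x) && ge_idx (f y, y) (f x, x)]| < k)%N].

(* k is counted from 1. *)
Definition kth_largest f k : R := (sort >=%R [seq f x | x : 'I_n])`_k.-1.

Definition near_tie_mass v k (eta : R) : nat :=
  #|[set x | `|v x - kth_largest v k| <= eta]|.

(* The base value 0 is immaterial when all intervals are nonempty. *)
Definition max_radius L U : R :=
  \big[Num.max/0]_(x : 'I_n) ((U x - L x) / 2).

Definition intervals_valid v L U : Prop := forall x, L x <= v x <= U x.

End Ranking.

(* All the choices that the description of the algorithm leaves open (ties for
   S_k, i, j and for the wider interval) are nondeterministic. The comparison
   [ge] is [ge_val] for the algorithm with plain comparisons of numbers,
   [ge_idx] when ties are resolved by the index order throughout. *)
Section ACE.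
Context {R : realType} {n : nat}.
Variables (ge : rel (R * 'I_n)) (v : 'I_n -> R) (k : nat).
Implicit Types (L U : 'I_n -> R) (S : {set 'I_n}).

Definition ace_select L U S (i j : 'I_n) : Prop :=
  [/\ is_topk ge U k S,
      i \in S /\ (forall x, x \in S -> ge (L x, x) (L i, i)) &
      j \notin S /\ (forall y, y \notin S -> ge (U j, j) (U y, y))].

Definition ace_returns L U S : Prop :=
  exists i j, ace_select L U S i j /\ ge (L i, i) (U j, j).

Definition ace_queries L U (x : 'I_n) : Prop :=
  exists S i j, [/\ ace_select L U S i j, ~~ ge (L i, i) (U j, j) &
    (x = i /\ U j - L j <= U i - L i) \/ (x = j /\ U i - L i <= U j - L j)].

(* [ace_reaches L0 U0 c L U]: from the initial intervals [L0, U0], some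
   execution issues c strong calls and then has current intervals [L, U]. *)
Inductive ace_reaches L0 U0 : nat -> ('I_n -> R) -> ('I_n -> R) -> Prop :=
| ace_init : ace_reaches L0 U0 0 L0 U0
| ace_step c L U x :
    ace_reaches L0 U0 c L U -> ace_queries L U x ->
    ace_reaches L0 U0 c.+1 [eta L with x |-> v x] [eta U with x |-> v x].

(* Every execution issues at most b strong calls and never gets stuck, hence
   terminates, and every set it can return satisfies [good]. *)
Definition ace_succeeds L0 U0 (b : nat) (good : {set 'I_n} -> Prop) : Prop :=
  forall c L U, ace_reaches L0 U0 c L U ->
    [/\ (c <= b)%N,
        (exists S, ace_returns L U S) \/ (exists x, ace_queries L U x) &
        forall S, ace_returns L U S -> good S].

End ACE.

(* With plain comparisons the algorithm may stop with L(i) = U(j) = v(i) = v(j),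
   so that a tie v_(k) = v_(k+1) need not be resolved as the index order does;
   the returned set is then some set of k items of largest value. *)
Definition ace_exact (R : realType) (n : nat) (v : 'I_n -> R) (k : nat)
    (L U : 'I_n -> R) : Prop :=
  let b := near_tie_mass v k (4 * max_radius L U) in
  ace_succeeds ge_val v k L U b
    (fun S => is_topk ge_val v k S /\
              (kth_largest v k.+1 < kth_largest v k -> S = topk v k)) /\
  ace_succeeds ge_idx v k L U b (fun S => S = topk v k).

Section WeakOracle.
Local Open Scope classical_set_scope.
Context {d : measure_display} {T : measurableType d} {R : realType}.
Context {P : probability T R} {n : nat}.
Implicit Types (X : nat -> {RV P >-> R}) (W : 'I_n -> nat -> {RV P >-> R}).

Definition iid X : Prop :=
  (forall j j' (A : set R), measurable A ->
     distribution P (X j) A = distribution P (X j') A) /\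
  (forall (J : seq nat) (A : nat -> set R), uniq J ->
     (forall j, measurable (A j)) ->
     P (\bigcap_(j in [set` J]) (X j @^-1` A j)) =
       (\prod_(j <- J) P (X j @^-1` A j))%E).

(* [W x j] is the answer to the j-th weak query on x. *)
Definition weak_oracle (v : 'I_n -> R) W : Prop :=
  [/\ forall x j w, 0 <= W x j w <= 1,
      forall x j, ('E_P[W x j] = (v x)%:E)%E,
      exists s : R, forall x j, ('V_P[W x j] <= s%:E)%E &
      forall x, iid (W x)].

Variables (W : 'I_n -> nat -> {RV P >-> R}) (N : nat) (r : 'I_n -> {RV P >-> R}).

Definition sample_mean (x : 'I_n) (w : T) : R := (\sum_(j < N) W x j w) / N%:R.

Definition weakL (w : T) (x : 'I_n) : R := sample_mean x w - r x w.
Definition weakU (w : T) (x : 'I_n) : R := sample_mean x w + r x w.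

Definition valid_half_widths (v delta_ : 'I_n -> R) (delta : R) : Prop :=
  (forall x, ((1 - delta_ x)%:E <= P [set w | (weakL w x <= v x <= weakU w x)%R])%E)
  /\ \sum_x delta_ x <= delta.

End WeakOracle.

(* Main.v *)
Require Import Defs.
From HB Require Import structures.
From mathcomp Require Import all_boot all_order all_algebra.
From mathcomp Require Import all_classical all_reals all_analysis.
From mathcomp Require Import measurable_realfun lra.
Import Order.TTheory GRing.Theory Num.Theory.
Import numFieldNormedType.Exports.
Local Open Scope ring_scope.

(** A non-stopping round has [L i <= U j <= U i]. Counting shows that [v_(k)] lies
    in [[L i, U i]]: the [k] items of [S_k] have value at least [L i], and the
    [k]-th largest [v] is at most the [k]-th largest [U], hence at most [U i].
    So the queried item is within two initial widths, i.e. four radii, of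
    [v_(k)]. Moreover its interval is nondegenerate, for otherwise both [i] and
    [j] would be degenerate and [L i = U i >= U j] would have stopped the round;
    hence no item is queried twice, and the queried items inject into the
    near-tie set. At a stop, [v x >= L x >= L i >= U j >= U y >= v y] for all
    [x] in [S_k] and [y] outside. Coverage is a union bound. *)

(** * The two comparisons, and uniqueness of the top set under [ge_idx] *)

Lemma ge_val_trans (R : realType) (n : nat) : transitive (@ge_val R n).
Proof. by move=> q p s; rewrite /ge_val => qp sq; exact: le_trans sq qp. Qed.

Lemma ge_val_total (R : realType) (n : nat) : total (@ge_val R n).
Proof. by move=> p q; exact: le_total. Qed.

Lemma ge_val_mono (R : realType) (n : nat) (x : 'I_n) (a b : R) :
  b <= a -> ge_val (a, x) (b, x).
Proof. by []. Qed.

Lemma ge_idx_trans (R : realType) (n : nat) : transitive (@ge_idx R n).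
Proof.
move=> [b y] [a x] [c z]; rewrite /ge_idx /=.
case/orP=> [ba|/andP[/eqP -> xy]] /orP[cb|/andP[/eqP e yz]].
- by rewrite (lt_trans cb ba).
- by rewrite -e ba.
- by rewrite cb.
- by rewrite e eqxx (leq_trans xy yz) orbT.
Qed.

Lemma ge_idx_total (R : realType) (n : nat) : total (@ge_idx R n).
Proof.
by move=> [a x] [b y]; rewrite /ge_idx /=; case: ltgtP => //= _; exact: leq_total.
Qed.

Lemma ge_idx_mono (R : realType) (n : nat) (x : 'I_n) (a b : R) :
  b <= a -> ge_idx (a, x) (b, x).
Proof. by rewrite /ge_idx /= leqnn andbT orbC eq_sym -le_eqVlt. Qed.

Lemma ge_idx_le (R : realType) (n : nat) (p q : R * 'I_n) :
  ge_idx p q -> q.1 <= p.1.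
Proof. by case/orP=> [/ltW //|/andP[/eqP ->]]. Qed.

Lemma ge_idx_anti (R : realType) (n : nat) : antisymmetric (@ge_idx R n).
Proof.
move=> [a x] [b y]; rewrite /ge_idx /=.
by case: ltgtP => //= -> /anti_leq/ord_inj ->.
Qed.

(** By antisymmetry, only the other [k - 1] members of [S] can beat a member of [S], whereas all [k]
    members beat an item outside. *)
Lemma topk_unique (R : realType) (n : nat) (f : 'I_n -> R) k S :
  is_topk ge_idx f k S -> S = topk f k.
Proof.
move=> [cS HS]; apply/setP => x; rewrite inE; case: (boolP (x \in S)) => xS.
  apply/esym; have : #|S :\ x|.+1 = k by rewrite -cS (cardsD1 x S) xS.
  move=> <-; rewrite ltnS subset_leq_card //; apply/fintype.subsetP => y.
  rewrite !inE => /andP[yx gyx]; rewrite yx /=; apply: contraT => yS.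
  have [_ exy] : (f x, x) = (f y, y).
    by apply: ge_idx_anti; rewrite gyx HS.
  by rewrite exy eqxx in yx.
apply/esym/negbTE; rewrite -leqNgt -cS subset_leq_card //.
apply/fintype.subsetP => y yS.
by rewrite inE HS // andbT; apply: contraNneq xS => <-.
Qed.

(** * Counting bounds for the k-th largest value *)

Section KthLargest.
Context {R : realType} {n : nat}.
Implicit Types (f : 'I_n -> R) (t : R).

Let sorted_scores f := sort >=%R [seq f x | x : 'I_n].

Let sorted_scoresP f i j : (i <= j < n)%N ->
  (sorted_scores f)`_j <= (sorted_scores f)`_i.
Proof.
move=> /andP[ij jn].
have ge_total : total (>=%R : rel R) by move=> a b; exact: le_total.
have ge_trans : transitive (>=%R : rel R).
  by move=> a b c ab ca; exact: le_trans ca ab.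
have sz : size (sorted_scores f) = n by rewrite size_sort size_map size_enum_ord.
have ge_refl : reflexive (>=%R : rel R) by move=> a; exact: lexx.
have := sorted_leq_nth ge_trans ge_refl 0
  (sort_sorted ge_total [seq f x | x : 'I_n]).
by move=> /(_ i j); apply; rewrite ?inE ?sz ?(leq_ltn_trans ij).
Qed.

Let count_scores f t :
  #|[set x | t <= f x]| = count (>= t) (sorted_scores f).
Proof.
rewrite count_sort count_map -sum1_count -sum1_card big_enum_cond /=.
by apply: eq_bigl => x; rewrite inE.
Qed.

Lemma le_kth_largest f k t : (0 < k <= n)%N ->
  (k <= #|[set x | (t <= f x)%R]|)%N -> t <= kth_largest f k.
Proof.
move=> /andP[k0 kn]; rewrite count_scores => kc; rewrite leNgt; apply/negP => lt.
move: kc; apply/negP; rewrite -ltnNge -(cat_take_drop k.-1 (sorted_scores f)).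
have sz : size (sorted_scores f) = n by rewrite size_sort size_map size_enum_ord.
(* The entries from index [k.-1] on are at most the k-th largest, hence below [t]; only the first
   [k.-1] entries can reach [t]. *)
rewrite count_cat [X in (_ + X)%N](_ : _ = 0)%N; last first.
  apply/eqP; rewrite -leqn0 leqNgt -has_count -all_predC.
  apply/(all_nthP 0) => i; rewrite size_drop sz ltn_subRL => ik.
  rewrite nth_drop /= -ltNge; apply: le_lt_trans lt.
  by apply: sorted_scoresP; rewrite leq_addr.
rewrite addn0 (leq_ltn_trans (count_size _ _)) // size_takel ?sz ?prednK //.
exact: leq_trans (leq_pred _) kn.
Qed.

Lemma card_ge_kth_largest f k : (0 < k <= n)%N ->
  (k <= #|[set x | (kth_largest f k <= f x)%R]|)%N.
Proof.
move=> /andP[k0 kn]; rewrite count_scores -(cat_take_drop k (sorted_scores f)).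
have sz : size (sorted_scores f) = n by rewrite size_sort size_map size_enum_ord.
have szt : size (take k (sorted_scores f)) = k by rewrite size_takel // sz.
rewrite count_cat (leq_trans _ (leq_addr _ _)) // -[X in (X <= _)%N]szt.
rewrite leq_eqVlt eq_sym -all_count; apply/orP; left; apply/(all_nthP 0) => i.
rewrite szt => ik; rewrite /= nth_take //; apply: sorted_scoresP.
by rewrite -ltnS prednK // ik.
Qed.

End KthLargest.

(** * Runs of ACE, for any comparison with the properties common to [ge_val] and [ge_idx] *)

Section TotalComparison.
Context {R : realType} {n : nat} (ge : rel (R * 'I_n)).
Hypotheses (ge_trans : transitive ge) (ge_total : total ge).
Hypothesis ge_mono : forall x a b, b <= a -> ge (a, x) (b, x).
Hypothesis ge_le : forall p q, ge p q -> q.1 <= p.1.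
Implicit Types (f v L U : 'I_n -> R) (S : {set 'I_n}) (k : nat).

Let ge_refl : reflexive ge.
Proof. by move=> p; rewrite -[ge p p]orbb; exact: ge_total. Qed.

Lemma exists_greatest f S x : x \in S ->
  exists2 j, j \in S & forall y, y \in S -> ge (f j, j) (f y, y).
Proof.
move=> xS; case: (@extremumP _ _ ge x (mem S) (fun x => (f x, x))) => //.
by move=> j jS Hj; exists j.
Qed.

Lemma exists_least f S x : x \in S ->
  exists2 i, i \in S & forall y, y \in S -> ge (f y, y) (f i, i).
Proof.
move=> xS.
case: (@extremumP _ _ (fun p q => ge q p) x (mem S) (fun x => (f x, x))) => //.
- by move=> b a c ba cb; exact: ge_trans cb ba.
- by move=> j jS Hj; exists j.
Qed.

Lemma exists_notin S : (#|S| < n)%N -> exists y, y \notin S.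
Proof.
move=> cS; have : (0 < #|~: S|)%N.
  by rewrite -(ltn_add2l #|S|) addn0 cardsC card_ord.
by case/card_gt0P => y; rewrite inE => yS; exists y.
Qed.

(** Greedy construction: a greatest item of the complement joins a top set of size [k]. *)
Lemma exists_topk f k : (k <= n)%N -> exists S, is_topk ge f k S.
Proof.
elim: k => [|k IH] kn.
  by exists finset.set0; split=> [|x y]; rewrite ?cards0 ?inE.
have [S [cS HS]] := IH (ltnW kn).
have [y yS] : exists y, y \notin S by apply: exists_notin; rewrite cS.
have [j jS Hj] : exists2 j, j \in ~: S &
    forall y, y \in ~: S -> ge (f j, j) (f y, y).
  by apply: (@exists_greatest f (~: S) y); rewrite inE.
exists (j |: S); split; first by rewrite cardsU1 cS -finset.in_setC jS.
move=> a b; rewrite !inE negb_or => /orP[/eqP -> | aS] /andP[_ bS].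
  by apply: Hj; rewrite inE.
exact: HS.
Qed.

(** If [f x < t], every item scoring at least [t] lies in [S] and differs from [x], which leaves at
    most [k - 1] of them. *)
Lemma topk_ge f k S x t : is_topk ge f k S -> x \in S ->
  (k <= #|[set y | (t <= f y)%R]|)%N -> t <= f x.
Proof.
move=> [cS HS] xS; rewrite leNgt => kc; apply/negP => lt.
move: kc; apply/negP; rewrite -ltnNge -cS (cardsD1 x S) xS ltnS.
apply/subset_leq_card/fintype.subsetP => y; rewrite !inE => ty; apply/andP; split.
  by apply: contraTneq ty => ->; rewrite -ltNge.
apply: contraT => yS; have /ge_le /= := HS _ _ xS yS.
by move=> /le_lt_trans/(_ lt); rewrite ltNge ty.
Qed.

Section Run.
Variables (v : 'I_n -> R) (k : nat).
Hypothesis kn : (0 < k < n)%N.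

Let kle : (0 < k <= n)%N.
Proof. by case/andP: kn => -> /ltnW. Qed.

(** A candidate [i] exists because [0 < k], and [j] because [k < n]. *)
Lemma ace_progress L U :
  (exists S, ace_returns ge k L U S) \/ (exists x, ace_queries ge k L U x).
Proof.
have [S HS] := exists_topk U k (proj2 (andP kle)).
have [cS _] := HS; case/andP: kn => k0 kltn.
have [x xS] : exists x, x \in S by apply/card_gt0P; rewrite cS.
have [y yS] : exists y, y \notin S by apply: exists_notin; rewrite cS.
have [i iS Hi] := exists_least L S x xS.
have [j jS Hj] : exists2 j, j \in ~: S &
    forall y, y \in ~: S -> ge (U j, j) (U y, y).
  by apply: (@exists_greatest U (~: S) y); rewrite inE.
have sel : ace_select ge k L U S i j.
  split=> //; split; first by rewrite -finset.in_setC.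
  by move=> z zS; apply: Hj; rewrite inE.
case: (boolP (ge (L i, i) (U j, j))) => stop; first by left; exists S, i, j.
right; case: (leP (U j - L j) (U i - L i)) => [le|/ltW le].
  by exists i, S, i, j; split=> //; left.
by exists j, S, i, j; split=> //; right.
Qed.

Lemma ace_returns_topk L U S : intervals_valid v L U ->
  ace_returns ge k L U S -> is_topk ge v k S.
Proof.
move=> val [i [j [[[cS _] [iS Hi] [jS Hj]] stop]]]; split=> // x y xS yS.
have [/andP[Lx _] /andP[_ Uy]] := (val x, val y).
(* The chain runs in [ge] rather than in values, so the tie-breaking of [ge] carries over to the
   returned set. *)
apply: ge_trans (ge_mono _ _ _ Lx) _; apply: ge_trans (Hi _ xS) _.
by apply: ge_trans stop _; apply: ge_trans (Hj _ yS) (ge_mono _ _ _ Uy).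
Qed.

Lemma ace_queries_wide L U x : ace_queries ge k L U x -> L x != U x.
Proof.
move=> [S [i [j [[[_ HS] [iS _] [jS _]] nstop xij]]]].
apply: contra nstop => /eqP eLU.
have Uij := HS _ _ iS jS; have := ge_le _ _ Uij => /= leU.
(* The queried interval is the wider one and has width zero, so that of [i] has no positive width,
   even when [x] is [j]. *)
have Li : U i <= L i by case: xij => -[xE]; subst x; lra.
exact: ge_trans (ge_mono _ _ _ Li) Uij.
Qed.

(* Both [v_(k)] and [v i] lie in [[L i, U i]], and without stopping
   [[L j, U j]] meets that interval. *)
Lemma ace_queries_near L U e x : intervals_valid v L U ->
  (forall y, U y - L y <= 2 * e) -> ace_queries ge k L U x ->
  `|v x - kth_largest v k| <= 4 * e.
Proof.
move=> val wide [S [i [j [[[cS HS] [iS Hi] [jS Hj]] nstop xij]]]].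
have /ge_le /= Uij := HS _ _ iS jS.
have /ge_le /= Lij : ge (U j, j) (L i, i).
  by have := ge_total (L i, i) (U j, j); rewrite (negbTE nstop).
have tU : kth_largest v k <= U i.
  apply: (@topk_ge U k S i) => //; apply: leq_trans (card_ge_kth_largest v k kle) _.
  apply/subset_leq_card/fintype.subsetP => y; rewrite !inE => /le_trans; apply.
  by case/andP: (val y).
have Lt : L i <= kth_largest v k.
  apply: le_kth_largest => //; rewrite -cS.
  apply/subset_leq_card/fintype.subsetP => y /Hi /ge_le /= Ly; rewrite inE.
  by apply: le_trans Ly _; case/andP: (val y).
have [/andP[Li Ui] /andP[Lj Uj]] := (val i, val j).
have [wi wj] := (wide i, wide j); rewrite ler_norml.
(* For [i] one width suffices. For [j], the value exceeds [v_(k)] by at most [U i - L i], and falls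
   short by at most [U i - L j <= (U i - L i) + (U j - L j)]: two widths, each at most [2 * e]. *)
by case: xij => -[-> _]; apply/andP; split; lra.
Qed.

(** [Q] collects the items queried so far. Their intervals are points, so [ace_queries_wide] makes
    each new query enlarge [Q] by one. *)
Lemma ace_reaches_inv L0 U0 c L U : intervals_valid v L0 U0 ->
  ace_reaches ge v k L0 U0 c L U ->
  [/\ intervals_valid v L U, forall y, U y - L y <= 2 * max_radius L0 U0 &
      exists Q : {set 'I_n}, [/\ #|Q| = c, {in Q, L =1 U} &
        Q \subset [set x | `|v x - kth_largest v k| <= 4 * max_radius L0 U0]]].
Proof.
move=> val0; elim=> [|{}c {}L {}U x _ [val wide [Q [cQ LU Qnear]]] qx].
  split=> // [y|]; last first.
    exists finset.set0; split; rewrite ?cards0 ?finset.sub0set // => y.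
    by rewrite inE.
  have : (U0 y - L0 y) / 2 <= max_radius L0 U0.
    exact: (le_bigmax _ (fun x => (U0 x - L0 x) / 2)).
  lra.
(* The base value 0 of the maximum gives nonnegativity, which bounds the zero width of the freshly
   queried interval. *)
have e0 : 0 <= max_radius L0 U0 by exact: bigmax_ge_id.
split=> [y|y|].
- by rewrite /=; case: eqP => [->|_]; [rewrite lexx | exact: val].
- by rewrite /=; case: eqP => [_|_]; [rewrite subrr mulr_ge0 | exact: wide].
exists (x |: Q); split.
- rewrite cardsU1 cQ (_ : x \notin Q) //.
  by apply: contra (ace_queries_wide _ _ _ qx) => /LU ->.
- move=> y; rewrite !inE /=; case: eqP => //= _; exact: LU.
- by rewrite finset.subUset Qnear andbT finset.sub1set inE (ace_queries_near L U).
Qed.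

Lemma ace_correct L U : intervals_valid v L U ->
  ace_succeeds ge v k L U (near_tie_mass v k (4 * max_radius L U))
    (is_topk ge v k).
Proof.
move=> val0 c L' U' /(ace_reaches_inv _ _ _ _ _ val0)[val _ [Q [<- _ Qnear]]].
split; first exact: subset_leq_card.
- exact: ace_progress.
- by move=> S; exact: ace_returns_topk.
Qed.

End Run.
End TotalComparison.

(** The [k + 1] items of [y |: S] all have value at least [v y], so [v y] is at most [v_(k+1)],
    while members of [S] reach [v_(k)]. The gap makes the comparison strict, and no tie is left to
    the indices. *)
Lemma topk_gap (R : realType) (n : nat) (v : 'I_n -> R) k S : (0 < k < n)%N ->
  kth_largest v k.+1 < kth_largest v k -> is_topk ge_val v k S ->
  is_topk ge_idx v k S.
Proof.
move=> /andP[k0 kn] gap top; have [cS HS] := top; split=> // x y xS yS.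
have tx : kth_largest v k <= v x.
  apply: (@topk_ge _ _ ge_val _ v k S x) => //; apply: card_ge_kth_largest.
  by rewrite k0 ltnW.
have ty : v y <= kth_largest v k.+1.
  apply: le_kth_largest => //.
  have <- : #|y |: S| = k.+1 by rewrite cardsU1 yS cS.
  apply/subset_leq_card/fintype.subsetP => z; rewrite !inE => /orP[/eqP -> //|zS].
  exact: HS zS yS.
by rewrite /ge_idx /= (le_lt_trans ty (lt_le_trans gap tx)).
Qed.

Lemma ace_exact_valid (R : realType) (n : nat) (v : 'I_n -> R) k L U :
  (0 < k < n)%N -> intervals_valid v L U -> ace_exact v k L U.
Proof.
move=> kn val; split=> c L' U' reach.
  have [bound progress good] := ace_correct ge_val (@ge_val_trans R n)
    (@ge_val_total R n) (@ge_val_mono R n) (fun _ _ => id) v k kn L U val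
    c L' U' reach.
  split=> // S /good top; split=> // gap.
  exact/topk_unique/topk_gap.
have [bound progress good] := ace_correct ge_idx (@ge_idx_trans R n)
  (@ge_idx_total R n) (@ge_idx_mono R n) (@ge_idx_le R n) v k kn L U val
  c L' U' reach.
by split=> // S /good; exact: topk_unique.
Qed.

Local Open Scope classical_set_scope.
Local Open Scope ring_scope.

(** * Joint coverage by a union bound *)

Section Coverage.
Context {d : measure_display} {T : measurableType d} {R : realType}.
Context {P : probability T R} {n : nat}.
Variables (W : 'I_n -> nat -> {RV P >-> R}) (N : nat) (r : 'I_n -> {RV P >-> R}).

Lemma measurable_covered (v : 'I_n -> R) x :
  measurable [set w | weakL W N r w x <= v x <= weakU W N r w x].
Proof.
have ms : measurable_fun setT (sample_mean W N x).
  by apply: measurable_funM => //; exact: measurable_sum.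
have mL : measurable_fun setT (fun w => weakL W N r w x) by exact: measurable_funB.
have mU : measurable_fun setT (fun w => weakU W N r w x) by exact: measurable_funD.
rewrite (_ : mkset _ = [set w | weakL W N r w x <= v x] `&`
                       [set w | v x <= weakU W N r w x]); last first.
  by apply/seteqP; split=> w /= /andP.
by apply: measurableI; rewrite -[X in measurable X]setTI;
  exact: measurable_fun_le.
Qed.

Lemma coverage (v delta_ : 'I_n -> R) (delta : R) :
  valid_half_widths W N r v delta_ delta ->
  exists B : set T, [/\ measurable B, (P B <= delta%:E)%E &
    [set w | ~ intervals_valid v (weakL W N r w) (weakU W N r w)] `<=` B].
Proof.
move=> [cover sum_delta].
pose C x := [set w | weakL W N r w x <= v x <= weakU W N r w x].
have mC x : measurable (C x) by exact: measurable_covered.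
have mC' x : measurable (~` C x) by exact: measurableC.
have PC' x : (P (~` C x) <= (delta_ x)%:E)%E.
  rewrite probability_setC // leeBlDr ?fin_num_measure // addeC -leeBlDr //.
  by rewrite -EFinB; exact: cover.
(* Indexing the union by the sequence [index_enum] lets [fsbig_seq] turn the finitely supported sum
   into the sum over items. *)
pose B := \bigcup_(x in [set` index_enum 'I_n]) ~` C x.
have mB : measurable B by apply: fin_bigcup_measurable => // x _; exact: mC'.
exists B; split=> //; last first.
  by move=> w /= /existsNP[x Cx]; exists x => //=; rewrite mem_index_enum.
have /le_trans : (P B <= \sum_(x \in [set` index_enum 'I_n]) P (~` C x))%E.
  by apply: content_sub_fsum.
apply; rewrite -fsbig_seq ?index_enum_uniq //.
rewrite (le_trans (lee_sum _ (fun x _ => PC' x))) // sumEFin lee_fin.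
exact: sum_delta.
Qed.

End Coverage.

Theorem theorem5 (R : realType) (d : measure_display) (T : measurableType d)
    (P : probability T R) (n k N : nat) (hk : (1 <= k < n)%N) (hN : (0 < N)%N)
    (v : 'I_n -> R) (hv : forall x, 0 <= v x <= 1)
    (W : 'I_n -> nat -> {RV P >-> R}) (hW : weak_oracle v W)
    (r : 'I_n -> {RV P >-> R}) (delta_ : 'I_n -> R) (delta : R)
    (hr : valid_half_widths W N r v delta_ delta) :
  (forall w : T, intervals_valid v (weakL W N r w) (weakU W N r w) ->
     ace_exact v k (weakL W N r w) (weakU W N r w)) /\
  (exists B : set T,
     [/\ measurable B, (P B <= delta%:E)%E &
         [set w | ~ ace_exact v k (weakL W N r w) (weakU W N r w)] `<=` B]).
Proof.
split=> [w|]; first exact: ace_exact_valid.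
have [B [mB PB subB]] := coverage W N r v delta_ delta hr.
(* By contraposition, failure of exactness forces invalid intervals; enclosing it in [B] avoids
   asking whether the failure set is measurable. *)
exists B; split=> // w /= fails; apply: subB => /= val.
exact/fails/ace_exact_valid.
Qed.
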